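(* Let $(G,\tau,\oplus)$ be a strongly topological gyrogroup with a symmetric neighborhood base $\mathscr U$ at $0$, and let $H$ be a locally compact admissible subgyrogroup of $G$ generated from $\mathscr U$. Let $\pi:G\to G/H$ be the natural quotient mapping from $G$ onto the quotient space $G/H$. Then there exists an open neighborhood $U$ of the identity element $0$ such that $\pi(\overline U)$ is closed in $G/H$ and the restriction of $\pi$ to $\overline U$ is a perfect mapping from $\overline U$ onto the subspace $\pi(\overline U)$.
   Context: All topological spaces are assumed to be Hausdorff. A gyrogroup is a nonempty set $G$ with a binary operation $\oplus$ such that: (G1) there is a unique element $0\in G$ with $0\oplus a=a=a\oplus 0$ for all $a\in G$; (G2) each $x\in G$ has a unique inverse $\ominus x$ with $\ominus x\oplus x=0=x\oplus(\ominus x)$; (G3) for all $x,y\in G$ there is an automorphism $\mathrm{gyr}[x,y]$ of $(G,\oplus)$ with $x\oplus(y\oplus z)=(x\oplus y)\oplus \mathrm{gyr}[x,y](z)$ for all $z\in G$; (G4) $\mathrm{gyr}[x\oplus y,y]=\mathrm{gyr}[x,y]$ for all $x,y\in G$. For subsets, $A\oplus B=\{a\oplus b:a\in A,b\in B\}$ and $\ominus A=\{\ominus a:a\in A\}$. A subgyrogroup of $G$ is a nonempty subset closed under $\ominus$ and $\oplus$. It is an $L$-subgyrogroup if moreover $\mathrm{gyr}[a,h](H)=H$ for all $a\in G$, $h\in H$. A topological gyrogroup $(G,\tau,\oplus)$ is a gyrogroup with a topology $\tau$ such that $\oplus:G\times G\to G$ is jointly continuous and $x\mapsto\ominus x$ is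 continuous. It is a strongly topological gyrogroup with a symmetric neighborhood base $\mathscr U$ at $0$ if $\mathscr U$ is a neighborhood base of $0$ such that for every $U\in\mathscr U$, $\ominus U=U$ and $\mathrm{gyr}[x,y](U)=U$ for all $x,y\in G$. A subgyrogroup $H$ of a topological gyrogroup $G$ is admissible if there is a sequence $\{U_n:n\in\omega\}$ of open symmetric neighborhoods of $0$ with $U_{n+1}\oplus(U_{n+1}\oplus U_{n+1})\subset U_n$ for each $n\in\omega$ and $H=\bigcap_{n\in\omega}U_n$. If $G$ is a strongly topological gyrogroup with symmetric neighborhood base $\mathscr U$ at $0$ and the $U_n$ can be chosen with every $U_n\in\mathscr U$, then $H$ is said to be generated from $\mathscr U$. Such an $H$ is a closed $L$-subgyrogroup of $G$. $H$ is locally compact in the subspace topology. For an $L$-subgyrogroup $H$, $G/H=\{a\oplus H:a\in G\}$ is a partition of $G$; $\pi:G\to G/H$ is $\pi(a)=a\oplus H$, and $G/H$ carries the quotient topology ($O\subset G/H$ is open iff $\pi^{-1}(O)$ is open in $G$). A continuous mapping $f:X\to Y$ is perfect if it is closed (images of closed sets are closed) and all fibers $f^{-1}(y)$ are compact. *)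

(* Defs.v *)
From HB Require Import structures.
From mathcomp Require Import all_boot generic_quotient.
From mathcomp Require Import all_classical topology.

Set Implicit Arguments.
Unset Strict Implicit.
Unset Printing Implicit Defensive.

Declare Scope gyro_scope.
Delimit Scope gyro_scope with gyro.
Local Open Scope classical_set_scope.
Local Open Scope gyro_scope.

Reserved Notation "x ⊕ y" (at level 50, left associativity).
Reserved Notation "⊖ x" (at level 35, right associativity).

(* [gyr] is carried as data.  This adds no structure: by left cancellation the
   law [gyraddA] determines [gyr x y] uniquely. *)
HB.mixin Record isGyrogroup G := {
  gyr0 : G;
  gyropp : G -> G;
  gyradd : G -> G -> G;
  gyr : G -> G -> G -> G;
  gyr0_unique :
    unique (fun e => forall a, gyradd e a = a /\ gyradd a e = a) gyr0;
  gyropp_unique : forall x,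
    unique (fun y => gyradd y x = gyr0 /\ gyradd x y = gyr0) (gyropp x);
  gyr_bij : forall x y, bijective (gyr x y);
  gyr_morph : forall x y a b,
    gyr x y (gyradd a b) = gyradd (gyr x y a) (gyr x y b);
  gyraddA : forall x y z,
    gyradd x (gyradd y z) = gyradd (gyradd x y) (gyr x y z);
  gyr_loop : forall x y, gyr (gyradd x y) y = gyr x y
}.

#[short(type="gyrogroupType")]
HB.structure Definition Gyrogroup := { G of isGyrogroup G }.

Arguments gyr0 {_}.

Notation "0" := gyr0 : gyro_scope.
Notation "x ⊕ y" := (gyradd x y) : gyro_scope.
Notation "⊖ x" := (gyropp x) : gyro_scope.

HB.mixin Record Gyrogroup_isTopological G
    of isGyrogroup G & Topological G := {
  gyradd_continuous : continuous (fun p : G * G => p.1 ⊕ p.2);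
  gyropp_continuous : continuous (fun x : G => ⊖ x)
}.

#[short(type="topologicalGyrogroupType")]
HB.structure Definition TopologicalGyrogroup :=
  { G of isGyrogroup G & Topological G & Gyrogroup_isTopological G }.

Definition gyradd_set (G : gyrogroupType) (A B : set G) : set G :=
  [set a ⊕ b | a in A & b in B].

Definition gyropp_set (G : gyrogroupType) (A : set G) : set G :=
  [set ⊖ a | a in A].

Definition subgyrogroup (G : gyrogroupType) (H : set G) : Prop :=
  [/\ H !=set0,
      forall x, H x -> H (⊖ x) &
      forall x y, H x -> H y -> H (x ⊕ y)].

Definition symmetric_nbhs_base (G : topologicalGyrogroupType)
    (UU : set (set G)) : Prop :=
  [/\ forall U, UU U -> nbhs (0 : G) U,
      forall V, nbhs (0 : G) V -> exists2 U, UU U & U `<=` V,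
      forall U, UU U -> gyropp_set U = U &
      forall U, UU U -> forall x y : G, gyr x y @` U = U].

Definition admissible_seq (G : topologicalGyrogroupType)
    (U : nat -> set G) (H : set G) : Prop :=
  [/\ forall n, open_nbhs (0 : G) (U n),
      forall n, gyropp_set (U n) = U n,
      forall n, gyradd_set (U n.+1) (gyradd_set (U n.+1) (U n.+1)) `<=` U n &
      H = \bigcap_n U n].

Definition admissible (G : topologicalGyrogroupType) (H : set G) : Prop :=
  subgyrogroup H /\ exists U, admissible_seq U H.

Definition generated_from (G : topologicalGyrogroupType)
    (UU : set (set G)) (H : set G) : Prop :=
  exists2 U, admissible_seq U H & forall n, UU (U n).

Definition left_coset (G : gyrogroupType) (H : set G) (a : G) : set G :=
  [set a ⊕ h | h in H].

(* The type whose points are the sets [left_coset H a].  It makes sense for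
   every [H]; the cosets partition [G] when [H] is an L-subgyrogroup. *)
Definition coset_space (G : gyrogroupType) (H : set G) : Type :=
  set_type (range (left_coset H)).

Section CosetQuotient.
Variables (G : gyrogroupType) (H : set G).

Definition to_coset (a : G) : coset_space H :=
  SigSub (mem_set (imageT (left_coset H) a)).

Lemma to_coset_surj (c : coset_space H) : exists a, to_coset a = c.
Proof.
case: c => A AP; have [a _ aA] := set_mem AP.
by exists a; apply: val_inj.
Qed.

Definition coset_repr (c : coset_space H) : G := projT1 (cid (to_coset_surj c)).

Lemma coset_reprK : cancel coset_repr to_coset.
Proof. by move=> c; rewrite /coset_repr; case: cid. Qed.

HB.instance Definition _ := isQuotient.Build G (coset_space H) coset_reprK.

End CosetQuotient.

Definition coset_quotient (G : topologicalGyrogroupType) (H : set G) :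
    topologicalType :=
  quotient_topology (coset_space H).

Definition coset_pi (G : topologicalGyrogroupType) (H : set G) :
    G -> coset_quotient H :=
  @to_coset G H.

Lemma coset_quotient_openE (G : topologicalGyrogroupType) (H : set G)
    (O : set (coset_quotient H)) :
  open O = open (coset_pi H @^-1` O).
Proof. by rewrite {1}/open /= /quotient_open unlock. Qed.

Definition perfect_map (X Y : topologicalType) (f : X -> Y) : Prop :=
  [/\ continuous f,
      forall C : set X, closed C -> closed (f @` C) &
      forall y : Y, compact (f @^-1` [set y])].

(* [f] restricted to [A], as a map between the subtypes [A] and [f @` A],
   which carry the subspace topologies. *)
Definition restrict_map (X Y : topologicalType) (f : X -> Y) (A : set X) :
    A -> f @` A :=
  sigLR [fun f in A].
Arguments restrict_map {X Y} f A.

(* Main.v *)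
Require Import Defs.
From mathcomp Require Import all_boot.
From mathcomp Require Import all_classical topology.

Local Open Scope classical_set_scope.
Local Open Scope gyro_scope.

(** Why the theorem holds.  Local compactness of [H] gives a compact [K] in
    [H] and a neighborhood [V] of [0] such that [V `&` H `<=` K].  Choose an
    open [W] around [0] so small that [⊖ a ⊕ (n ⊕ (m ⊕ b))] stays in [V] for
    [n], [m] in [W] and [a], [b] in [closure W] ([nbhs0_quotient]); this [W]
    is the required neighborhood.

    Fibers: if [x] and [x ⊕ h] both lie in [closure W], then
    [h = ⊖ x ⊕ (x ⊕ h)] lies in [V `&` H], hence in [K].  The fiber through
    [x] is therefore [closure W `&` (x ⊕ K)], which is compact.

    Closedness: the preimage of [coset_pi H @` F] is [F ⊕ H], so it suffices
    that [F ⊕ H] be closed for every closed [F `<=` closure W]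
    ([closed_gyradd_subgyrogroup]).  Let [x] be adherent to [F ⊕ H].  Some
    [f0 ⊕ h0] is so close to [x] that [x = n ⊕ (f0 ⊕ h0)] with [n] in [W].
    Since [H] is invariant under gyrations, [x] and [p = n ⊕ f0] lie in the
    same coset, and [p] is again adherent to [F ⊕ H].  Now every [f ⊕ h] close
    enough to [p] is [m ⊕ (n ⊕ f0)] with [m] in [W], which forces [h] into
    [K]; so [p] is adherent to [F ⊕ K].  That set is closed, as [F] is closed
    and [K] compact ([closed_gyradd_compact]), whence [p], and with it [x],
    lies in [F ⊕ H].

    Writing [x] as [n ⊕ z] with [n] close to [0] requires a continuous right
    division.  It comes from the left Bol identity [gyradd_Bol], which
    expresses it by [⊕] and [⊖] alone. *)

(** * Cancellation and division in a gyrogroup *)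

Section GyrogroupAlgebra.
Context {G : gyrogroupType}.
Implicit Types a b x y z u : G.

Lemma gyradd0l a : 0 ⊕ a = a.
Proof. by have [/(_ a)[]] := @gyr0_unique G. Qed.

Lemma gyradd0r a : a ⊕ 0 = a.
Proof. by have [/(_ a)[]] := @gyr0_unique G. Qed.

Lemma gyraddNl a : ⊖ a ⊕ a = 0.
Proof. by have [[]] := @gyropp_unique G a. Qed.

Lemma gyraddNr a : a ⊕ ⊖ a = 0.
Proof. by have [[]] := @gyropp_unique G a. Qed.

Lemma gyroppK a : ⊖ ⊖ a = a.
Proof. by have [_] := @gyropp_unique G (⊖ a); apply; rewrite gyraddNl gyraddNr. Qed.

Lemma gyr_inj x y : injective (gyr x y).
Proof. exact/bij_inj/gyr_bij. Qed.

Lemma gyradd_injr a : injective (gyradd a).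
Proof.
move=> b c /(congr1 (gyradd (⊖ a))).
by rewrite !gyraddA gyraddNl !gyradd0l => /gyr_inj.
Qed.

Lemma gyr0l y z : gyr 0 y z = z.
Proof. by apply: (@gyradd_injr y); rewrite -{1}(gyradd0l y) -gyraddA gyradd0l. Qed.

Lemma gyraddKl a b : ⊖ a ⊕ (a ⊕ b) = b.
Proof. by rewrite gyraddA gyraddNl gyradd0l -gyr_loop gyraddNl gyr0l. Qed.

Lemma gyraddNKl a b : a ⊕ (⊖ a ⊕ b) = b.
Proof. by rewrite -{1}(gyroppK a) gyraddKl. Qed.

(** This is the left Bol identity [(u ⊕ (z ⊕ u)) ⊕ w = u ⊕ (z ⊕ (u ⊕ w))] at
    [w = ⊖ u].  With [y = z ⊕ u] one has [u = ⊖ z ⊕ y], so the loop property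
    replaces [gyr u y] by [gyr (⊖ z) y], whose value at [⊖ y ⊕ z] is read off
    from the gyroassociative law.  It is what gives right division. *)
Lemma gyradd_Bol u z : (u ⊕ (z ⊕ u)) ⊕ ⊖ u = u ⊕ z.
Proof.
set y := z ⊕ u.
have uE : ⊖ z ⊕ y = u by rewrite gyraddKl.
have gyrE : gyr u y (⊖ y ⊕ z) = ⊖ u.
  apply: (@gyradd_injr u); rewrite gyraddNr -{1 2}uE gyr_loop -gyraddA.
  by rewrite gyraddNKl gyraddNl.
by rewrite -gyrE -gyraddA gyraddNKl.
Qed.

(** Right division, the solution [x] of [x ⊕ a = b].  It equals the
    gyrogroup cosubtraction [b ⊕ ⊖ gyr b a a], but this form contains no
    gyration, so its joint continuity is immediate. *)
Definition gyrsub b a := ⊖ a ⊕ ((a ⊕ b) ⊕ ⊖ a).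

Lemma gyraddK a b : gyrsub (b ⊕ a) a = b.
Proof. by rewrite /gyrsub gyradd_Bol gyraddKl. Qed.

Lemma gyrsubK a b : gyrsub b a ⊕ a = b.
Proof. by rewrite /gyrsub -{4}(gyroppK a) gyradd_Bol gyraddKl. Qed.

Lemma gyrsubxx a : gyrsub a a = 0.
Proof. by rewrite -{1}(gyradd0l a) gyraddK. Qed.

End GyrogroupAlgebra.

(** * Cosets of a gyration-invariant subgyrogroup *)

Section Cosets.
Context {G : gyrogroupType}.

Lemma subgyrogroup0 {H : set G} : subgyrogroup H -> H 0.
Proof.
by move=> [[h Hh] HN HD]; rewrite -(gyraddNl h); apply: HD => //; exact: HN.
Qed.

Definition gyr_invariant (H : set G) : Prop :=
  forall x y : G, gyr x y @` H = H.

(** Injectivity of gyrations is what makes the image commute with the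
    intersection. *)
Lemma gyr_invariant_bigcap (U : nat -> set G) :
  (forall n, gyr_invariant (U n)) -> gyr_invariant (\bigcap_n U n).
Proof.
move=> invU x y; apply/seteqP; split=> [_ [h Hh <-] n _|h Hh].
  by rewrite -(invU n x y); exists h => //; exact: Hh.
have [g fK gK] := gyr_bij x y.
exists (g h); last exact: gK.
move=> n _; have := Hh n I; rewrite -{1}(invU n x y) => -[w Uw wh].
by rewrite -wh fK.
Qed.

(** Gyroassociativity turns [(f ⊕ k) ⊕ h] into [f ⊕ (k ⊕ h')], where [h] is a
    gyration of [h']; invariance puts [h'] in [H]. *)
Lemma gyradd_set_stable (H F : set G) :
  subgyrogroup H -> gyr_invariant H ->
  forall x h, gyradd_set F H x -> H h -> gyradd_set F H (x ⊕ h).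
Proof.
move=> [_ _ HD] invH _ h [f Ff [k Hk <-]] Hh.
move: Hh; rewrite -{1}(invH f k) => -[h' Hh' <-].
by rewrite -gyraddA; exists f => //; exists (k ⊕ h') => //; exact: HD.
Qed.

Lemma left_coset_sym (H : set G) : subgyrogroup H -> gyr_invariant H ->
  forall x y, left_coset H x y -> left_coset H y x.
Proof.
move=> [_ HN _] invH x _ [h Hh <-]; exists (gyr x h (⊖ h)).
  by rewrite -(invH x h); exists (⊖ h) => //; exact: HN.
by rewrite -gyraddA gyraddNr gyradd0r.
Qed.

Lemma left_coset_sub (H : set G) : subgyrogroup H -> gyr_invariant H ->
  forall x y, left_coset H x y -> left_coset H y `<=` left_coset H x.
Proof.
move=> HS invH x y xy _ [h Hh <-].
have [|_ <- //] := @gyradd_set_stable H [set x] HS invH y h _ Hh.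
  by case: xy => k Hk <-; exists x => //; exists k.
Qed.

End Cosets.

(** * The quotient map *)

Lemma coset_pi_eq {G : topologicalGyrogroupType} {H : set G} :
  subgyrogroup H -> gyr_invariant H ->
  forall x y, coset_pi H y = coset_pi H x <-> left_coset H x y.
Proof.
move=> HS invH x y; split=> [yx|xy].
  have <- : left_coset H y = left_coset H x.
    exact: (congr1 (fun c : coset_space H => sval c) yx).
  by exists 0; [exact: subgyrogroup0|exact: gyradd0r].
have E : left_coset H y = left_coset H x.
  apply/seteqP; split; apply: left_coset_sub => //.
  exact: left_coset_sym.
exact: (@val_inj _ _ (coset_space H)).
Qed.

Lemma coset_pi_saturation {G : topologicalGyrogroupType} {H : set G} :
  subgyrogroup H -> gyr_invariant H ->
  forall F : set G,
    coset_pi H @^-1` (coset_pi H @` F) = gyradd_set F H.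
Proof.
move=> HS invH F; apply/seteqP; split=> x /=.
  move=> [f Ff /esym/(coset_pi_eq HS invH)[h Hh <-]].
  by exists f => //; exists h.
move=> [f Ff [h Hh <-]]; exists f => //; apply/esym/(coset_pi_eq HS invH).
by exists h.
Qed.

Lemma coset_pi_continuous {G : topologicalGyrogroupType} (H : set G) :
  continuous (coset_pi H).
Proof. by apply/continuousP => O; rewrite coset_quotient_openE. Qed.

Lemma closed_coset_image {G : topologicalGyrogroupType} (H F : set G) :
  subgyrogroup H -> gyr_invariant H ->
  closed (gyradd_set F H) -> closed (coset_pi H @` F).
Proof.
move=> HS invH cFH; rewrite -openC coset_quotient_openE preimage_setC openC.
by move: cFH; rewrite -(coset_pi_saturation HS invH).
Qed.

(** * Topology of a gyrogroup *)

Section TopologicalGyrogroup.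
Context {G : topologicalGyrogroupType}.

Lemma continuous_gyradd (T : topologicalType) (f g : T -> G) :
  continuous f -> continuous g -> continuous (fun t => f t ⊕ g t).
Proof.
move=> fc gc t.
apply: (@continuous_comp _ _ _ (fun t => (f t, g t)) (fun p => p.1 ⊕ p.2)).
  by apply: cvg_pair; [exact: fc|exact: gc].
exact: gyradd_continuous.
Qed.

Lemma continuous_gyropp (T : topologicalType) (f : T -> G) :
  continuous f -> continuous (fun t => ⊖ f t).
Proof.
move=> fc t; apply: continuous_comp; first exact: fc.
exact: gyropp_continuous.
Qed.

Lemma continuous_gyrsub (T : topologicalType) (f g : T -> G) :
  continuous f -> continuous g -> continuous (fun t => gyrsub (f t) (g t)).
Proof.
move=> fc gc; apply: continuous_gyradd; first exact: continuous_gyropp.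
by apply: continuous_gyradd; [exact: continuous_gyradd|exact: continuous_gyropp].
Qed.

(** Regularity at [0]: if [x] is adherent to [W] then some [z] in [W] is so
    close to [x] that [x = z ⊕ (⊖ z ⊕ x)] with [⊖ z ⊕ x] close to [0]. *)
Lemma nbhs0_closure (V : set G) : nbhs (0 : G) V ->
  exists W : set G, open_nbhs (0 : G) W /\ closure W `<=` V.
Proof.
move=> V0.
have : nbhs ((0 : G), (0 : G)) ((fun p : G * G => p.1 ⊕ p.2) @^-1` V).
  by apply: gyradd_continuous; rewrite /= gyradd0l.
case=> -[A B] /= [A0 B0] ABV; exists (interior A); split.
  by split; [exact: open_interior|exact: A0].
move=> x clx.
have NB : nbhs x ((fun z => ⊖ z ⊕ x) @^-1` B).
  apply: continuous_gyradd; last by rewrite /= gyraddNl.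
    by apply: continuous_gyropp => ?; exact: cvg_id.
  exact: cst_continuous.
have [z [Az Bz]] := clx _ NB.
rewrite -(gyraddNKl z x); apply: (ABV (z, ⊖ z ⊕ x)); split=> //=.
exact: interior_subset.
Qed.

(** The neighborhood of the theorem.  The two inner factors are there because
    the closedness argument moves twice by elements of [W]: from the adherent
    point to its representative [n ⊕ f0], and from there to nearby points. *)
Lemma nbhs0_quotient (V : set G) : nbhs (0 : G) V ->
  exists W : set G, open_nbhs (0 : G) W /\
    forall a n m b, closure W a -> W n -> W m -> closure W b ->
      V (⊖ a ⊕ (n ⊕ (m ⊕ b))).
Proof.
move=> V0; pose q (p : (G * G) * (G * G)) :=
  ⊖ p.1.1 ⊕ (p.1.2 ⊕ (p.2.1 ⊕ p.2.2)).
have qc : continuous q.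
  apply: continuous_gyradd.
    apply: continuous_gyropp => p.
    by apply: continuous_comp; [exact: cvg_fst|exact: cvg_fst].
  apply: continuous_gyradd => [p|].
    by apply: continuous_comp; [exact: cvg_fst|exact: cvg_snd].
  apply: continuous_gyradd => p.
    by apply: continuous_comp; [exact: cvg_snd|exact: cvg_fst].
  by apply: continuous_comp; [exact: cvg_snd|exact: cvg_snd].
have : nbhs (((0 : G), (0 : G)), ((0 : G), (0 : G))) (q @^-1` V).
  by apply: qc; rewrite /q /= gyraddKl gyradd0l.
case=> -[A B] /= [[[A1 A2] /= [A10 A20] AS] [[B1 B2] /= [B10 B20] BS]] ABV.
have [W [W0 WS]] := nbhs0_closure (A1 `&` A2 `&` (B1 `&` B2))
  (filterI (filterI A10 A20) (filterI B10 B20)).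
exists W; split=> // a n m b Wa Wn Wm Wb.
apply: (ABV ((a, n), (m, b))); split=> /=.
  by apply: AS; split=> /=;
    [have [[]] := WS _ Wa|have [[]] := WS _ (subset_closure Wn)].
by apply: BS; split=> /=;
  [have [_ []] := WS _ (subset_closure Wm)|have [_ []] := WS _ Wb].
Qed.

(** [z] lies in [F ⊕ K] iff [gyrsub z k] lies in [F] for some [k] in [K], so
    [F ⊕ K] is the projection along the compact set [K] of a closed set. *)
Lemma closed_gyradd_compact (F K : set G) :
  closed F -> compact K -> closed (gyradd_set F K).
Proof.
move=> cF /compact_near_coveringP cK; rewrite -openC openE => p pFK.
have : \forall z \near p, K `<=` [set k | ~ F (gyrsub z k)].
  apply: (cK _ (nbhs p) (fun z k => ~ F (gyrsub z k))) => k Kk.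
  have nF : ~ F (gyrsub p k).
    move=> Fpk; apply: pFK; exists (gyrsub p k) => //; exists k => //.
    exact: gyrsubK.
  have sc : continuous (fun q : G * G => gyrsub q.2 q.1).
    apply: continuous_gyrsub => q; [exact: cvg_snd|exact: cvg_fst].
  have nbF : nbhs (gyrsub (k, p).2 (k, p).1) (~` F).
    by apply: open_nbhs_nbhs; split=> //; rewrite openC.
  exact: sc nbF.
apply: filterS => z Kz [f Ff [k Kk fkz]].
by apply: (Kz _ Kk); rewrite -fkz gyraddK.
Qed.

End TopologicalGyrogroup.

(** * Restrictions of maps to subspaces *)

Section Perfect.
Context {X Y : topologicalType}.

Lemma closed_set_val (A : set X) (C : set A) :
  closed A -> closed C -> closed (set_val @` C).
Proof.
move=> cA; rewrite -openC => -[O oO OC].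
have CE (a : A) : C a <-> ~ O (set_val a).
  have -> : O (set_val a) <-> ~ C a by rewrite -[~ C a]/((~` C) a) -OC.
  by split=> [Ca|/contrapT//]; exact.
suff -> : set_val @` C = A `&` ~` O by apply: closedI => //; rewrite closedC.
apply/seteqP; split=> [_ [c /CE Cc <-]|x [Ax Ox]].
  by split; first exact: set_valP.
by exists (SigSub (mem_set Ax)) => //; apply/CE.
Qed.

Lemma compact_set_val (A B : set X) :
  compact (A `&` B) -> compact ((set_val : A -> X) @^-1` B).
Proof.
move=> cAB F PF FB.
have FAB : ((set_val : A -> X) @ F) (A `&` B).
  rewrite /fmap /=; apply: (@filterS _ F) FB => a Ba.
  by split; [exact: set_valP|exact: Ba].
have [p [[Ap Bp] clp]] := cAB _ (fmap_proper_filter _ PF) FAB.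
exists (SigSub (mem_set Ap)); split=> // D E FD [_ [[O oO <-] Op OE]].
have FD' : ((set_val : A -> X) @ F) (set_val @` D).
  by rewrite /fmap /=; apply: (@filterS _ F) FD => d Dd; exists d.
have [_ [[d Dd <-] Od]] := clp _ O FD' (open_nbhs_nbhs (conj oO Op)).
by exists d; split=> //; exact: OE.
Qed.

(** The hypotheses mention only subsets of [X] and [Y], so that perfectness of
    the restriction can be checked without the subtypes. *)
Lemma perfect_restrict_map (f : X -> Y) (A : set X) :
  continuous f -> closed A ->
  (forall C, closed C -> C `<=` A -> closed (f @` C)) ->
  (forall x, A x -> compact (A `&` f @^-1` [set f x])) ->
  perfect_map (restrict_map f A).
Proof.
move=> fc cA fcl fcpt.
have valE a : set_val (restrict_map f A a) = f (set_val a) by [].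
split.
- apply: continuous_comp_initial => a.
  apply: (@continuous_comp _ _ _ (set_val : A -> X) f); last exact: fc.
  exact: initial_continuous.
- move=> C cC.
  have -> : restrict_map f A @` C = set_val @^-1` (f @` (set_val @` C)).
    apply/seteqP; split=> [_ [c Cc <-]|y [_ [c Cc <-] cy]] /=.
      by exists (set_val c) => //; exists c.
    by exists c => //; apply: val_inj.
  apply: (continuous_closedP _).1; first exact: initial_continuous.
  apply: fcl; first exact: closed_set_val.
  by move=> _ [c _ <-]; exact: set_valP.
- move=> y; have [x Ax fxy] := set_valP y.
  have -> : restrict_map f A @^-1` [set y] = set_val @^-1` (f @^-1` [set f x]).
    apply/seteqP; split=> a /= => [ay|fa].
      by rewrite fxy -ay.
    by apply: val_inj; rewrite -!set_valE valE fa.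
  exact/compact_set_val/fcpt.
Qed.

Lemma range_restrict_map (f : X -> Y) (A : set X) :
  range (restrict_map f A) = setT.
Proof.
apply/seteqP; split=> // y _; have [x Ax fxy] := set_valP y.
by exists (SigSub (mem_set Ax)) => //; apply: val_inj.
Qed.

End Perfect.

Lemma locally_compact_nbhs {X : topologicalType} (A : set X) (x : X) :
  locally_compact [set: A] -> A x ->
  exists K V : set X, [/\ compact K, K `<=` A, nbhs x V & V `&` A `<=` K].
Proof.
move=> lcA Ax; pose xA : A := SigSub (mem_set Ax).
have [K nK [cK _]] := lcA xA I.
have [_ [[V oV <-] Vx VK]] : nbhs xA K.
  by apply: (@filterS _ (nbhs xA) _ _ _ _ nK) => a; exact.
exists (set_val @` K), V; split.
- apply: continuous_compact => //; apply: continuous_subspaceT.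
  exact: initial_continuous.
- by move=> _ [k _ <-]; exact: set_valP.
- exact: open_nbhs_nbhs.
- move=> z [Vz Az]; exists (SigSub (mem_set Az)) => //; exact: VK.
Qed.

(** * Perfectness of the quotient map near the identity *)

(** An adherent point [x] of [F ⊕ H] is first moved inside its coset to a point
    [p] close to [F]; near [p] only factors from the compact set [K] matter, so
    [closed_gyradd_compact] applies to [p]. *)
Lemma closed_gyradd_subgyrogroup {G : topologicalGyrogroupType}
    (H K V W : set G) :
  subgyrogroup H -> gyr_invariant H -> compact K -> K `<=` H ->
  V `&` H `<=` K -> nbhs (0 : G) W ->
  (forall a n m b, closure W a -> W n -> W m -> closure W b ->
      V (⊖ a ⊕ (n ⊕ (m ⊕ b)))) ->
  forall F, closed F -> F `<=` closure W -> closed (gyradd_set F H).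
Proof.
move=> HS invH cK KH VHK W0 WV F cF FW x clx.
have idc : continuous (@id G) by move=> ?; exact: cvg_id.
have Wl u : nbhs u [set z | W (gyrsub u z)].
  apply: (continuous_gyrsub _ (fun=> u) id) => //; first exact: cst_continuous.
  by rewrite gyrsubxx.
have Wr u : nbhs u [set z | W (gyrsub z u)].
  apply: (continuous_gyrsub _ id (fun=> u)) => //; first exact: cst_continuous.
  by rewrite gyrsubxx.
have [_ [[f0 Ff0 [h0 Hh0 <-]] /= Wn]] := clx _ (Wl x).
set n := gyrsub x (f0 ⊕ h0) in Wn.
pose p := n ⊕ f0.
have px : left_coset H p x.
  exists (gyr n f0 h0); first by rewrite -(invH n f0); exists h0.
  by rewrite -gyraddA /n gyrsubK.
have [k Hk pE] : left_coset H x p by exact: left_coset_sym.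
(* Right translation by [k] maps [F ⊕ H] into itself. *)
have clp : closure (gyradd_set F H) p.
  rewrite -pE => B B0.
  have nB : nbhs x [set z | B (z ⊕ k)].
    apply: (continuous_gyradd _ id (fun=> k)) => //; exact: cst_continuous.
  have [z [FHz Bz]] := clx _ nB; exists (z ⊕ k); split=> //.
  exact: gyradd_set_stable.
suff [f Ff [h Kh fhp]] : gyradd_set F K p.
  case: px => j Hj <-; apply: gyradd_set_stable => //.
  by rewrite -fhp; exists f => //; exists h => //; exact: KH.
apply: closed_gyradd_compact => // B Bp.
have [_ [[f Ff [h Hh <-]] [/= Bfh Wm]]] := clp _ (filterI Bp (Wr p)).
exists (f ⊕ h); split=> //; exists f => //; exists h => //.
(* [h = ⊖ f ⊕ (m ⊕ (n ⊕ f0))] with [m = gyrsub (f ⊕ h) p] in [W]. *)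
apply: VHK; split=> //; rewrite -(gyraddKl f h) -(gyrsubK p (f ⊕ h)).
by apply: WV => //; exact: FW.
Qed.

Theorem theorem3p4 (G : topologicalGyrogroupType) (UU : set (set G))
    (H : set G) :
  hausdorff_space G ->
  symmetric_nbhs_base UU ->
  admissible H ->
  generated_from UU H ->
  locally_compact [set: H] ->
  exists U : set G,
    [/\ open_nbhs (0 : G) U,
        closed (coset_pi H @` closure U),
        perfect_map (restrict_map (coset_pi H) (closure U)) &
        range (restrict_map (coset_pi H) (closure U)) = setT].
Proof.
move=> _ [_ _ _ gyrUU] [HS _] [U [_ _ _ HE] UUU] lcH.
have invH : gyr_invariant H.
  by rewrite HE; apply: gyr_invariant_bigcap => n x y; exact: gyrUU.
have H0 := subgyrogroup0 HS.
have [K [V [cK KH V0 VHK]]] := locally_compact_nbhs _ _ lcH H0.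
have [W [W0 WV]] := nbhs0_quotient _ V0.
have W0' := open_nbhs_nbhs W0.
have Wcl F : closed F -> F `<=` closure W -> closed (coset_pi H @` F).
  move=> cF FW; apply: closed_coset_image => //.
  exact: (@closed_gyradd_subgyrogroup _ H K V W).
exists W; split=> //.
- by apply: Wcl => //; exact: closed_closure.
- apply: perfect_restrict_map => //; first exact: coset_pi_continuous.
    exact: closed_closure.
  move=> x Wx.
  have -> : closure W `&` coset_pi H @^-1` [set coset_pi H x] =
            gyradd x @` K `&` closure W.
    apply/seteqP; split=> y.
      move=> [Wy /(coset_pi_eq HS invH)[h Hh xhy]]; split=> //.
      exists h => //; apply: VHK; split=> //.
      (* [h = ⊖ x ⊕ (0 ⊕ (0 ⊕ y))], an instance of [WV]. *)
      rewrite -(gyraddKl x h) xhy -(gyradd0l y) -(gyradd0l (0 ⊕ y)).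
      by apply: WV => //; exact: nbhs_singleton.
    move=> [[k Kk <-] Wk]; split=> //; apply/(coset_pi_eq HS invH).
    by exists k => //; exact: KH.
  apply: compact_closedI; last exact: closed_closure.
  apply: continuous_compact => //; apply: continuous_subspaceT.
  apply: continuous_gyradd; first exact: cst_continuous.
  by move=> ?; exact: cvg_id.
- exact: range_restrict_map.
Qed.
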